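(* Let $m=3^k$ with $k\in\mathbb{N}$, $k\geq1$. Then there exists an integer $a$ with $1\leq a<m$ and $\gcd(a,3)=1$ such that $K_{\mathbb{C}}(a/m)\leq 8$.
   Context: For $z\in\mathbb{C}$, $[z]:=\lfloor \mathrm{Re}(z)+\tfrac12\rfloor+i\lfloor \mathrm{Im}(z)+\tfrac12\rfloor$. Let $\mathfrak{F}=\{z\in\mathbb{C}: -\tfrac12\leq\mathrm{Re}(z)<\tfrac12,\ -\tfrac12\leq\mathrm{Im}(z)<\tfrac12\}$ and $T:\mathfrak{F}\to\mathfrak{F}$, $T(z)=z^{-1}-[z^{-1}]$ for $z\neq0$, $T(0)=0$. For $z\in\mathfrak{F}\setminus\{0\}$, $a_1(z)=[z^{-1}]$ and, while $T^{n-1}(z)\neq0$, $a_n(z)=a_1(T^{n-1}(z))$. For general $z\in\mathbb{C}$, $a_0(z)=[z]$ and $a_n(z)=a_n(z-a_0(z))$ for $n\geq1$. For $z\in\mathbb{Q}(i)$ the sequence terminates, giving the Hurwitz continued fraction $[a_0(z);a_1(z),\ldots,a_n(z)]_{\mathbb{C}}$, and $K_{\mathbb{C}}(z):=\max(|a_1(z)|,\ldots,|a_n(z)|)$ (the term $a_0$ is not included). *)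

(* Defs.v *)
From HB Require Import structures.
From mathcomp Require Import all_boot all_order all_algebra.
From mathcomp Require Import boolp classical_sets reals complex.
From mathcomp Require Import ring lra zify.

Set Implicit Arguments.
Unset Strict Implicit.
Unset Printing Implicit Defensive.

Import Order.TTheory GRing.Theory Num.Theory.
Local Open Scope ring_scope.
Local Open Scope complex_scope.

Definition hurwitz_round (R : realType) (z : R[i]) : R[i] :=
  (Num.floor (complex.Re z + 2%:R^-1))%:~R +i*
  (Num.floor (complex.Im z + 2%:R^-1))%:~R.

Definition hurwitz_dom (R : realType) : set R[i] :=
  [set z | - 2%:R^-1 <= complex.Re z < 2%:R^-1 /\
           - 2%:R^-1 <= complex.Im z < 2%:R^-1]%classic.

(* Total on R[i]; only iterated from points of hurwitz_dom, which it maps into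
   itself (hurwitz_T_dom). *)
Definition hurwitz_T (R : realType) (z : R[i]) : R[i] :=
  if z == 0 then 0 else z^-1 - hurwitz_round z^-1.

Definition hurwitz_rem (R : realType) (z : R[i]) (n : nat) : R[i] :=
  iter n (@hurwitz_T R) (z - hurwitz_round z).

(* The partial quotient a_n.+1 is only meaningful when hurwitz_rem z n != 0;
   otherwise the value is the junk value 0. *)
Definition hurwitz_pq (R : realType) (z : R[i]) (n : nat) : R[i] :=
  if n is n'.+1 then hurwitz_round (hurwitz_rem z n')^-1
  else hurwitz_round z.

(* Index of the last partial quotient. The junk value 0 for non-terminating
   expansions never occurs on Q(i) (hurwitz_lenP). *)
Definition hurwitz_len (R : realType) (z : R[i]) : nat :=
  match pselect (exists n, hurwitz_rem z n == 0) with
  | left ex_n => ex_minn ex_n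
  | right _ => 0%N
  end.

(* ComplexField.Normc.normc is the R-valued modulus. The maximum is 0 when
   z is a Gaussian integer, i.e. when there is no partial quotient but a_0. *)
Definition hurwitz_K (R : realType) (z : R[i]) : R :=
  \big[Num.max/0]_(1 <= j < (hurwitz_len z).+1)
    ComplexField.Normc.normc (hurwitz_pq z j).

Definition gauss_rat (R : realType) : set R[i] :=
  [set z | exists x y : rat, z = ratr x +i* ratr y]%classic.

Section Termination.
Variable R : realType.
Implicit Types z p q : R[i].

Lemma hurwitz_round_dom z : hurwitz_dom (z - hurwitz_round z).
Proof.
case: z => x y; rewrite /hurwitz_dom /hurwitz_round /=.
have := floor_le (x + 2%:R^-1); have := floorD1_gt (x + 2%:R^-1).
have := floor_le (y + 2%:R^-1); have := floorD1_gt (y + 2%:R^-1).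
rewrite !intrD; move: (Num.floor _)%:~R (Num.floor _)%:~R => u v.
by move=> *; split; apply/andP; split; lra.
Qed.

Lemma hurwitz_T_dom z : hurwitz_dom (hurwitz_T z).
Proof.
rewrite /hurwitz_T; case: eqP => _; last exact: hurwitz_round_dom.
by rewrite /hurwitz_dom /=; split; apply/andP; split; lra.
Qed.

Let sqn z : R := complex.Re z ^+ 2 + complex.Im z ^+ 2.

Let sqnM p q : sqn (p * q) = sqn p * sqn q.
Proof. by case: p q => [a b] [c d]; rewrite /sqn /=; ring. Qed.

Let sqn_eq0 z : sqn z = 0 -> z = 0.
Proof.
case: z => a b /eqP; rewrite /sqn /= paddr_eq0 ?sqr_ge0 // !sqrf_eq0.
by case/andP => /eqP -> /eqP ->.
Qed.

Let sqn_dom z : hurwitz_dom z -> sqn z < 1.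
Proof. by case: z => a b [] /= /andP[a1 a2] /andP[b1 b2]; rewrite /sqn /=; nra. Qed.

Let gint z := exists x y : int, z = x%:~R +i* y%:~R.

Let gint_step p q z : gint p -> gint q -> gint (q - hurwitz_round z * p).
Proof.
move=> [a [b ->]] [c [d ->]]; rewrite /hurwitz_round.
move: (Num.floor _) (Num.floor _) => v u.
exists (c - (u * a - v * b)), (d - (u * b + v * a)).
by apply/eqP; rewrite eq_complex /=; apply/andP; split; apply/eqP; ring.
Qed.

Let iterT_quot N p q : gint p -> gint q -> q != 0 -> sqn q < N%:R ->
  hurwitz_dom (p / q) -> exists n, iter n (@hurwitz_T R) (p / q) == 0.
Proof.
elim: N p q => [|N IHN] p q gp gq q0 ltqN dompq.
  by move: ltqN; rewrite ltNge addr_ge0 ?sqr_ge0.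
have [->|p0] := eqVneq p 0; first by exists 0%N; rewrite mul0r.
have pq0 : p / q != 0 by rewrite mulf_neq0 ?invr_eq0.
have defT : hurwitz_T (p / q) = (q - hurwitz_round (p / q)^-1 * p) / p.
  by rewrite /hurwitz_T (negPf pq0) mulrBl mulfK // invf_div.
have ltpq : sqn p < sqn q.
  have qgt0 : 0 < sqn q.
    by rewrite lt0r addr_ge0 ?sqr_ge0 // andbT; apply: contra q0 => /eqP/sqn_eq0->.
  by rewrite -[p](divfK q0) sqnM gtr_pMl // sqn_dom.
have ltpN : sqn p < N%:R.
  have intsqn z : gint z -> exists m : int, sqn z = m%:~R.
    move=> [x [y ->]]; exists (x ^+ 2 + y ^+ 2).
    by rewrite /sqn /= intrD !rmorphXn.
  have [m mE] := intsqn p gp; have [l lE] := intsqn q gq.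
  by move: ltpq ltqN; rewrite mE lE !pmulrn !ltr_int; lia.
have [n Hn] : exists n, iter n (@hurwitz_T R) (hurwitz_T (p / q)) == 0.
  rewrite defT; apply: IHN => //; first exact: gint_step.
  by rewrite -defT; apply: hurwitz_T_dom.
by exists n.+1; rewrite iterSr.
Qed.

Lemma hurwitz_rem_eventually0 z :
  gauss_rat z -> exists n, hurwitz_rem z n == 0.
Proof.
move=> [x [y zE]]; pose q : R[i] := ((denq x * denq y)%:~R)%:C.
have dx0 : (denq x)%:~R != 0 :> R by rewrite intr_eq0 denq_neq0.
have dy0 : (denq y)%:~R != 0 :> R by rewrite intr_eq0 denq_neq0.
have q0 : q != 0.
  by rewrite /q eq_complex /= eqxx andbT intrM mulf_neq0.
have gq : gint q by exists (denq x * denq y), 0.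
have gzq : gint (z * q).
  exists (numq x * denq y), (numq y * denq x).
  by rewrite zE /q; apply/eqP; rewrite eq_complex /= /ratr !intrM;
     apply/andP; split; apply/eqP; field; rewrite ?dx0 ?dy0.
rewrite /hurwitz_rem.
have -> : z - hurwitz_round z = (z * q - hurwitz_round z * q) / q.
  by rewrite -mulrBl mulfK.
apply: (@iterT_quot (Num.truncn (sqn q)).+1) => //.
- exact: gint_step.
- exact: truncnS_gt.
- by rewrite -mulrBl mulfK //; exact: hurwitz_round_dom.
Qed.

Lemma hurwitz_lenP z : gauss_rat z ->
  hurwitz_rem z (hurwitz_len z) = 0 /\
  forall n, (n < hurwitz_len z)%N -> hurwitz_rem z n != 0.
Proof.
move=> /hurwitz_rem_eventually0 zT; rewrite /hurwitz_len.
case: pselect => // ex_n; case: ex_minnP => m /eqP m0 mmin; split=> // n.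
by rewrite ltnNge; apply: contra => /mmin.
Qed.

End Termination.

(* Main.v *)
(* For a real argument the Hurwitz expansion is the nearest-integer continued
   fraction, and every finite sequence of integers of modulus at least 3 is
   such an expansion. Let a word (b, u, a) have denominator q, the bottom right
   entry of the product of the matrices [[0,1],[1,a_i]]. The folded words
     (b, u, a, 3, -a, -rev u, -b)   and   (b, u, a+1, a-1, rev u, b)
   have denominators ± 3 q^2 and q^2: the second one is the normal form of
   the folding (b, u, a, 1, -a, -rev u, -b). Both words start with b and end
   with ± b, so, if the ends of a word have modulus in [4, 7] and its other
   entries have modulus in [3, 8], the same holds after folding. This lifts
   the exponents 3, 4, 5 to every exponent at least 3. The numerator is prime
   to the denominator since the matrices are unimodular. *)
Require Import Defs.
From mathcomp Require Import all_boot all_order all_algebra.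
From mathcomp Require Import boolp classical_sets reals complex.
From mathcomp Require Import ring lra zify.

Set Implicit Arguments.
Unset Strict Implicit.
Unset Printing Implicit Defensive.

Import Order.TTheory GRing.Theory Num.Theory.
Local Open Scope ring_scope.

(** * Denominators as matrix entries *)

Definition pq_mx (a : int) : 'M[int]_2 :=
  \matrix_(i, j) if (i + j == 0)%N then 0 else if (i + j == 2)%N then a else 1.

Definition cf_mx (w : seq int) : 'M[int]_2 := \prod_(a <- w) pq_mx a.

Lemma mulmx2E (A B : 'M[int]_2) i j :
  (A * B) i j = A i 0 * B 0 j + A i 1 * B 1 j.
Proof.
rewrite -mulmxE mxE big_ord_recl big_ord1.
by congr (_ + _ * _); congr (fun_of_matrix _ _ _); apply: val_inj.
Qed.

Lemma cf_mx_cons a w : cf_mx (a :: w) = pq_mx a * cf_mx w.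
Proof. by rewrite /cf_mx big_cons. Qed.

Lemma cf_mx_cat w1 w2 : cf_mx (w1 ++ w2) = cf_mx w1 * cf_mx w2.
Proof. by rewrite /cf_mx big_cat. Qed.

Lemma cf_mx1 a : cf_mx [:: a] = pq_mx a.
Proof. by rewrite /cf_mx big_seq1. Qed.

Lemma cf_mx_cons0 a w j : cf_mx (a :: w) 0 j = cf_mx w 1 j.
Proof. by rewrite cf_mx_cons mulmx2E !mxE /= mul0r mul1r add0r. Qed.

Lemma cf_mx_cons1 a w j : cf_mx (a :: w) 1 j = cf_mx w 0 j + a * cf_mx w 1 j.
Proof. by rewrite cf_mx_cons mulmx2E !mxE /= mul1r. Qed.

(** Each factor [pq_mx a] is symmetric, so transposing reverses the product. *)
Lemma cf_mx_rev w : cf_mx (rev w) = (cf_mx w)^T.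
Proof.
elim: w => [|a w IHw]; first by rewrite /cf_mx !big_nil trmx1.
rewrite rev_cons -cats1 cf_mx_cat IHw cf_mx1 cf_mx_cons -!mulmxE trmx_mul.
by congr (_ *m _); apply/matrixP => i j; rewrite !mxE addnC.
Qed.

(** With D = diag(1, -1), [pq_mx (- a)] is - D [pq_mx a] D, and the inner D cancel in the
    product. *)
Lemma cf_mx_opp w i j :
  cf_mx (map -%R w) i j = (-1) ^+ (size w + i + j) * cf_mx w i j.
Proof.
elim: w i => [|a w IHw] i.
  rewrite /cf_mx !big_nil -[1]/(1%:M : 'M[int]_2) !mxE.
  by case: eqVneq => [->|_]; rewrite ?mulr0 // add0n addnn -signr_odd odd_double.
have [->|->] : i = 0 \/ i = 1.
  by case: i => [[|[|//]] ?]; [left | right]; apply: val_inj.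
  rewrite /= !cf_mx_cons0 IHw; congr (_ * _).
  by rewrite -!(signr_odd _ (_ + _)) !oddD /= ?addbF; case: odd; case: odd.
rewrite /= !cf_mx_cons1 !IHw /= !addn0 !addn1 !addSn !exprS.
by ring.
Qed.

Lemma cf_mx_det w :
  cf_mx w 0 0 * cf_mx w 1 1 - cf_mx w 0 1 * cf_mx w 1 0 = (-1) ^+ size w.
Proof.
elim: w => [|a w IHw]; first by rewrite /cf_mx big_nil !mxE.
by rewrite !cf_mx_cons0 !cf_mx_cons1 /= exprS -IHw; ring.
Qed.

Lemma cf_mx_coprime w : coprimez (cf_mx w 0 1) (cf_mx w 1 1).
Proof.
apply/coprimezP; pose s : int := (-1) ^+ size w.
(* Bezout coefficients from [cf_mx_det]; the factor [s] turns the determinant into s^2 = 1. *)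
exists (- s * cf_mx w 1 0, s * cf_mx w 0 0) => /=.
by rewrite -[RHS](sqrr_sign int (size w)) expr2 -{2}cf_mx_det -/s; ring.
Qed.

(** * Folding of words *)

(** Negating the reversed half makes the cross terms cancel, which leaves only the term through
    [x]. *)
Lemma cf_mx_fold w x :
  cf_mx (w ++ x :: map -%R (rev w)) 1 1 =
  (-1) ^+ size w * x * cf_mx w 1 1 ^+ 2.
Proof.
rewrite cf_mx_cat mulmx2E cf_mx_cons0 cf_mx_cons1 !cf_mx_opp cf_mx_rev !mxE.
by rewrite size_rev /= !addn0 !addn1 !exprS; ring.
Qed.

(** With (r, s) the bottom row of [cf_mx w], the two middle factors give the quadratic form r^2 + 2
    a r s + a^2 s^2 = (r + a s)^2. *)
Lemma cf_mx_fold1 w a :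
  cf_mx (w ++ [:: a + 1, a - 1 & rev w]) 1 1 = cf_mx (w ++ [:: a]) 1 1 ^+ 2.
Proof.
rewrite !cf_mx_cat cf_mx1 !mulmx2E !(cf_mx_cons0, cf_mx_cons1) cf_mx_rev !mxE /=.
by ring.
Qed.

(** The ends keep a margin of one because folding may replace [a] by [a + 1] and [a - 1]. Only [b]
    has a fixed sign; it will make the fraction positive. *)
Definition foldable (b : int) (u : seq int) (a : int) (k : nat) : Prop :=
  [/\ (4 <= b <= 7) && (4 <= `|a| <= 7),
      all (fun c => 3 <= `|c| <= 8) u
    & `|cf_mx (b :: u ++ [:: a]) 1 1| = (3 ^ k)%N%:Z].

Lemma foldable_double b u a k :
  foldable b u a k -> foldable b (u ++ [:: a + 1, a - 1 & rev u]) b k.*2.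
Proof.
case=> /andP[hb ha] hu hq; split.
- by move: hb; lia.
- by rewrite all_cat /= all_rev hu /= andbT; move: ha; lia.
- have := cf_mx_fold1 (b :: u) a; rewrite rev_cons -cats1 /= -!catA /= => ->.
  by rewrite normrX hq -addnn expnD PoszM.
Qed.

Lemma foldable_doubleS b u a k :
  foldable b u a k ->
  foldable b (u ++ [:: a, 3, - a & map -%R (rev u)]) (- b) k.*2.+1.
Proof.
case=> /andP[hb ha] hu hq; split.
- by move: hb; lia.
- have hu' : all (fun c => 3 <= `|c| <= 8) (map -%R (rev u)).
    by rewrite all_map all_rev; apply: sub_all hu => c /=; rewrite normrN.
  by rewrite all_cat /= hu hu' normrN !andbT /=; move: ha; lia.
- have := cf_mx_fold (b :: u ++ [:: a]) 3.
  rewrite rev_cons rev_cat /= -cats1 map_cat /= -!catA /= => ->.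
  rewrite normrM normrX hq mulrC normrM normrX normrN1 expr1n mul1r -addnn.
  by rewrite expnS expnD !PoszM mulrC.
Qed.

Lemma foldable_exists k : (3 <= k)%N -> exists b u a, foldable b u a k.
Proof.
elim/ltn_ind: k => k IHk k3.
(* From 6 on, halving keeps the exponent at least 3. *)
have [k6|k6] := leqP 6 k.
  have [||b [u [a H]]] := IHk k./2; [lia|lia|].
  rewrite -(odd_double_half k); case: odd.
    by do 3 eexists; exact: foldable_doubleS H.
  by do 3 eexists; exact: foldable_double H.
have [->|[->|->]] : k = 3%N \/ k = 4%N \/ k = 5%N by lia.
(* The denominators of the three base words are -27, 81 and -243. *)
- exists 7, [::], (-4);
  by split; rewrite ?(cf_mx_cons0, cf_mx_cons1) /cf_mx ?big_nil ?mxE.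
- exists 5, [:: -4], (-4);
  by split; rewrite ?(cf_mx_cons0, cf_mx_cons1) /cf_mx ?big_nil ?mxE.
- exists 7, [:: 7], (-5);
  by split; rewrite ?(cf_mx_cons0, cf_mx_cons1) /cf_mx ?big_nil ?mxE.
Qed.

(** * Words as Hurwitz expansions *)

Section NearestIntegerExpansion.
Variable R : realType.
Implicit Types (w : seq int) (x : R).
Local Open Scope complex_scope.

Fixpoint cf_val w : R := if w is a :: w' then (a%:~R + cf_val w')^-1 else 0.

(** The strict bound on every tail lets rounding recover each entry without ties; the bound 2 on
    entries keeps the denominators [a + cf_val w] nonzero. *)
Definition nearest_word w : Prop :=
  all (fun c : int => 2 <= `|c|) w /\
  forall n, `|cf_val (drop n w)| < 2^-1.

Lemma nearest_word_cons a w : nearest_word (a :: w) -> nearest_word w.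
Proof. by case=> /andP[_ hw] h; split=> // n; apply: h n.+1. Qed.

Lemma cf_val_lt_half w : nearest_word w -> `|cf_val w| < 2^-1.
Proof. by case=> _ /(_ 0%N); rewrite drop0. Qed.

Lemma normr_intr_ge (n : nat) (a : int) : n%:Z <= `|a| -> n%:R <= `|a%:~R : R|.
Proof. by move=> h; rewrite -intr_norm pmulrn ler_int. Qed.

(** By induction, a tail below 1/2 leaves |a + v| above 5/2, so its inverse is again below 1/2. *)
Lemma nearest_word_ge3 w : all (fun c : int => 3 <= `|c|) w -> nearest_word w.
Proof.
move=> hw; split; first by apply: sub_all hw => c /=; lia.
have H v : all (fun c : int => 3 <= `|c|) v -> `|cf_val v| < 2^-1.
  elim: v => [|a v IHv] /=; first by rewrite normr0 invr_gt0 ltr0n.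
  case/andP=> /(@normr_intr_ge 3) ha /IHv hv.
  have := lerB_dist (a%:~R) (- cf_val v); rewrite opprK normrN => hd.
  by rewrite normfV ltf_pV2 ?posrE ?ltr0n //; lra.
by move=> n; apply: H; apply/allP => c /mem_drop; exact: (allP hw).
Qed.

Lemma hurwitz_round_real x :
  hurwitz_round x%:C = ((Num.floor (x + 2^-1))%:~R)%:C.
Proof.
rewrite /hurwitz_round /= (_ : Num.floor (0 + 2^-1) = 0) //.
by apply: floor_def; rewrite add0r; apply/andP; split; lra.
Qed.

Lemma floor_half_int (a : int) x :
  `|x| < 2^-1 -> Num.floor (a%:~R + x + 2^-1) = a.
Proof.
rewrite ltr_norml => /andP[h1 h2]; apply: floor_def.
by rewrite intrD; apply/andP; split; lra.
Qed.

Lemma hurwitz_round_inv_cf_val a w : nearest_word (a :: w) ->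
  hurwitz_round ((cf_val (a :: w))%:C)^-1 = (a%:~R)%:C.
Proof.
move=> /nearest_word_cons/cf_val_lt_half h.
by rewrite -fmorphV /= invrK hurwitz_round_real floor_half_int.
Qed.

Lemma cf_val_denom_neq0 a w : nearest_word (a :: w) -> a%:~R + cf_val w != 0.
Proof.
move=> ha; have /cf_val_lt_half hv := nearest_word_cons ha.
case: ha => /= /andP[/(@normr_intr_ge 2) ha _] _.
by apply/eqP => /eqP; rewrite addr_eq0 => /eqP E; move: ha; rewrite E normrN; lra.
Qed.

(** Inverting the value gives [a] plus the tail, and rounding takes off [a]: the Hurwitz map acts as
    the shift on words. *)
Lemma hurwitz_T_cf_val a w : nearest_word (a :: w) ->
  hurwitz_T (cf_val (a :: w))%:C = (cf_val w)%:C.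
Proof.
move=> ha; rewrite /hurwitz_T hurwitz_round_inv_cf_val //.
rewrite fmorph_eq0 invr_eq0 (negPf (cf_val_denom_neq0 ha)).
by rewrite -fmorphV /= invrK -rmorphB /= addrC addKr.
Qed.

Lemma iter_hurwitz_T_cf_val w n : nearest_word w ->
  iter n (@hurwitz_T R) (cf_val w)%:C = (cf_val (drop n w))%:C.
Proof.
elim: n w => [|n IHn] w hw; first by rewrite drop0.
rewrite iterSr; case: w hw => [|a w] hw.
  by rewrite /= /hurwitz_T eqxx; apply: (IHn [::]).
by rewrite hurwitz_T_cf_val // IHn //; apply: nearest_word_cons hw.
Qed.

Lemma hurwitz_rem_cf_val w n : nearest_word w ->
  hurwitz_rem (cf_val w)%:C n = (cf_val (drop n w))%:C.
Proof.
move=> hw; rewrite /hurwitz_rem hurwitz_round_real.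
rewrite -{2}[cf_val w]add0r (@floor_half_int 0); last exact: cf_val_lt_half.
by rewrite subr0 iter_hurwitz_T_cf_val.
Qed.

(** Past the end of the word the remainder and its inverse are 0, so the junk quotient is 0 and the
    bound holds at every index, whatever [hurwitz_len] is. *)
Lemma hurwitz_K_cf_val w (N : nat) : nearest_word w ->
  all (fun c : int => `|c| <= N%:Z) w -> hurwitz_K (cf_val w)%:C <= N%:R.
Proof.
move=> hw hN; rewrite /hurwitz_K big_nat.
apply: (big_ind (fun x : R => x <= N%:R)) => //.
  by move=> x y hx hy; rewrite ge_max hx.
case=> [//|n] _; rewrite /hurwitz_pq hurwitz_rem_cf_val //.
case E: (drop n w) => [|a v].
  rewrite -fmorphV [(cf_val [::])^-1]invr0 hurwitz_round_real -{1}[0]addr0.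
  by rewrite (@floor_half_int 0 0) ?normr0 ?invr_gt0 ?ComplexField.Normc.normc0.
rewrite hurwitz_round_inv_cf_val; last first.
  split=> [|m]; rewrite -E; last by rewrite drop_drop; case: hw.
  by apply/allP => c /mem_drop; apply: (allP hw.1).
rewrite /ComplexField.Normc.normc /= expr0n addr0 sqrtr_sqr.
have : a \in w by apply: (@mem_drop n); rewrite E mem_head.
by move=> /(allP hN) /= ha; rewrite -intr_norm pmulrn ler_int.
Qed.

Lemma cf_val_mx w : nearest_word w ->
  (cf_mx w 1 1)%:~R != 0 :> R /\
  cf_val w = (cf_mx w 0 1)%:~R / (cf_mx w 1 1)%:~R.
Proof.
elim: w => [|a w IHw] hw; first by rewrite /cf_mx big_nil !mxE /= oner_neq0 mul0r.
have [q0 E] := IHw (nearest_word_cons hw); have := cf_val_denom_neq0 hw.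
rewrite cf_mx_cons0 cf_mx_cons1 /= E intrD intrM => d0.
have d : (cf_mx w 0 1)%:~R + a%:~R * (cf_mx w 1 1)%:~R =
   (cf_mx w 1 1)%:~R * (a%:~R + (cf_mx w 0 1)%:~R / (cf_mx w 1 1)%:~R) :> R.
  by field.
by rewrite d mulf_neq0 // invfM mulVKf.
Qed.

(** As [b] is positive and the tail exceeds -1/2, the value is positive, so the absolute value of
    the numerator serves whatever the sign of the denominator. *)
Lemma nearest_word_numerator b w (m N : nat) :
  nearest_word (b :: w) -> 0 < b ->
  all (fun c : int => `|c| <= N%:Z) (b :: w) ->
  `|cf_mx (b :: w) 1 1| = (3 ^ m.+1)%N%:Z ->
  exists a : int,
    [/\ 1 <= a < (3 ^ m.+1)%N%:Z,
        gcdz a 3%:Z = 1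
      & hurwitz_K (a%:~R / (3 ^ m.+1)%N%:R : R[i]) <= N%:R].
Proof.
move=> hw b0 hN hq; have [q0 E] := cf_val_mx hw.
have v0 : 0 < cf_val (b :: w).
  have := cf_val_lt_half (nearest_word_cons hw).
  rewrite /= invr_gt0 ltr_norml => /andP[h _].
  by move: b0; rewrite gtz0_ge1 -(ler_int R) => ?; lra.
have vE : cf_val (b :: w) = `|cf_mx (b :: w) 0 1|%:~R / (3 ^ m.+1)%N%:R.
  by rewrite -(gtr0_norm v0) {1}E normf_div -!intr_norm hq.
exists `|cf_mx (b :: w) 0 1|; split.
- apply/andP; split.
    rewrite -gtz0_ge1 normr_gt0; apply/eqP => p0.
    by move: v0; rewrite E p0 mul0r ltxx.
  have := cf_val_lt_half hw; rewrite (gtr0_norm v0) vE.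
  rewrite ltr_pdivrMr ?ltr0n ?expn_gt0 // => h.
  rewrite -(ltr_int R) -pmulrn; apply: (lt_trans h).
  by rewrite gtr_pMl ?ltr0n ?expn_gt0 // invf_lt1 ?ltr1n ?ltr0n.
- have := cf_mx_coprime (b :: w); rewrite coprimezE.
  have -> : absz (cf_mx (b :: w) 1 1)%R = (3 ^ m.+1)%N.
    by apply/eqP; rewrite -eqz_nat abszE hq.
  by rewrite coprime_pexpr // => /eqP co; rewrite /gcdz absz_id; congr Posz.
- rewrite -[X in hurwitz_K X](_ : (cf_val (b :: w))%:C = _).
    exact: hurwitz_K_cf_val.
  by rewrite vE rmorphM fmorphV /= rmorph_int rmorph_nat.
Qed.

End NearestIntegerExpansion.

Theorem theorem5p6 (R : realType) (k : nat) (hk : (1 <= k)%N) :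
  exists a : int,
    [/\ 1 <= a < (3 ^ k)%N%:Z,
        gcdz a 3%:Z = 1
      & hurwitz_K (a%:~R / (3 ^ k)%N%:R : R[i]) <= 8%:R].
Proof.
case: k hk => [//|m] _; have [m2|m2] := leqP 2 m.
  have [b [u [a [/andP[hb ha] hu hq]]]] := @foldable_exists m.+1 m2.
  apply: (@nearest_word_numerator R b (u ++ [:: a])) hq; last 2 first.
  - by move: hb; lia.
  - rewrite /= all_cat /=; apply/and4P; split; [lia| |lia|by []].
    by apply: sub_all hu => c /andP[].
  apply: nearest_word_ge3.
  rewrite /= all_cat /=; apply/and4P; split; [lia| |lia|by []].
  by apply: sub_all hu => c /andP[].
(* A foldable word has denominator of modulus above 9, so the exponents 1 and 2 take separate words,
   with values 1/3 and 4/9. *)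
have [->|->] : m = 0%N \/ m = 1%N by lia.
- apply: (@nearest_word_numerator R 3 [::]) => //; first exact: nearest_word_ge3.
  by rewrite cf_mx_cons1 /cf_mx big_nil !mxE.
- apply: (@nearest_word_numerator R 2 [:: 4]) => //; last first.
    by rewrite !cf_mx_cons1 cf_mx_cons0 /cf_mx big_nil !mxE.
  (* The entry 2 is too small for [nearest_word_ge3], so the tails are evaluated one by one. *)
  have v4 : cf_val R [:: 4] = 4^-1 by rewrite /= addr0.
  have v24 : cf_val R [:: 2; 4] = 4 / 9 by rewrite /= addr0; field.
  split=> // -[|[|n]].
  + by rewrite drop0 v24 ger0_norm; lra.
  + by rewrite -[drop _ _]/[:: 4%:Z] v4 ger0_norm; lra.
  + by rewrite [drop _ _]/= normr0 invr_gt0.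
Qed.
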